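(* Let $\alpha\in(0,1)$ and let $\widehat{\mathcal C^{\rm full}_{(1-\alpha)}}(X_{T+1})=\{y\in\mathbb R:\hat p(y)>\alpha\}$ be the full distributional conformal prediction set defined in the context. Let $F(y,x)=P(Y_t\le y\mid X_t=x)$ be the true conditional distribution function. Put $V_t:=\psi(F(Y_t,X_t))$ and $\hat V_t:=\hat V_t^{(Y_{T+1})}=\psi(\hat F^{(Y_{T+1})}(Y_t,X_t))$ for $1\le t\le T+1$, and suppose that the following hold as $T\to\infty$: 1. There exists a strictly increasing continuous function $\phi:[0,\infty)\to[0,\infty)$ with $\phi(0)=0$ such that $(T+1)^{-1}\sum_{t=1}^{T+1}\phi(|\hat V_t-V_t|)=o_P(1)$, and $\hat V_{T+1}=V_{T+1}+o_P(1)$. 2. $\sup_{v\in\mathbb R}|\tilde G(v)-G(v)|=o_P(1)$, where $\tilde G(v)=(T+1)^{-1}\sum_{t=1}^{T+1}\mathbf 1\{V_t<v\}$ and $G$ is the distribution function of $V_{T+1}$. 3. $\sup_{x_1\ne x_2}|G(x_1)-G(x_2)|/|x_1-x_2|$ is bounded (uniformly in $T$). Then, as $T\to\infty$, $$P\left(Y_{T+1}\in\widehat{\mathcal C^{\rm full}_{(1-\alpha)}}(X_{T+1})\;\Big|\;X_{T+1}\right)=1-\alpha+o_P(1).$$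
   Context: For each $T$, the data are random pairs $(Y_t,X_t)$, $1\le t\le T+1$, with $Y_t$ real-valued and $X_t$ a vector of predictors (not assumed independent or exchangeable). $F(y,x)=P(Y_t\le y\mid X_t=x)$ is the conditional distribution function (the same for all $t$), and $F(\cdot,X_t)$ is continuous almost surely. $\psi$ is a fixed deterministic (measurable) real-valued function, e.g. $\psi(u)=|u-1/2|$. For each $y\in\mathbb R$, the augmented data set is $Z^{(y)}=\{Z^{(y)}_t\}_{t=1}^{T+1}$ with $Z_t^{(y)}=(Y_t,X_t)$ for $1\le t\le T$ and $Z^{(y)}_{T+1}=(y,X_{T+1})$. $\hat F^{(y)}$ is an estimator of $F$ computed from $Z^{(y)}$ (any estimator, with $\hat F^{(y)}(\cdot,x)$ monotone). Set $\hat U_t^{(y)}=\hat F^{(y)}(Y_t,X_t)$ for $t\le T$, $\hat U^{(y)}_{T+1}=\hat F^{(y)}(y,X_{T+1})$, $\hat V_t^{(y)}=\psi(\hat U_t^{(y)})$, and $$\hat p(y)=\frac1{T+1}\sum_{t=1}^{T+1}\mathbf 1\{\hat V_t^{(y)}\ge\hat V_{T+1}^{(y)}\}.$$ *)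

(* Defs.v *)
From mathcomp Require Export all_boot all_order all_algebra.
From mathcomp Require Export all_classical all_reals all_analysis.
Export Order.TTheory GRing.Theory Num.Theory.
Export numFieldNormedType.Exports.

Set Implicit Arguments.
Unset Strict Implicit.
Unset Printing Implicit Defensive.

Local Open Scope classical_set_scope.
Local Open Scope ring_scope.

Definition distribution_function (R : realType) (f : R -> R) : Prop :=
  [/\ nondecreasing_fun f, right_continuous f,
      f x @[x --> -oo] --> (0 : R) & f x @[x --> +oo] --> (1 : R)].

Section conditional.
Context d d' (Omega : measurableType d) (E : measurableType d') (R : realType)
  (P : probability Omega R).

(* [h] is a version of x |-> P(A | X = x); the random variable P(A | X) is then
   [h \o X].  Versions exist by Radon-Nikodym and agree almost surely. *)
Definition cond_prob (A : set Omega) (X : {RV P >-> E}) (h : E -> R) : Prop :=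
  (distribution P X).-integrable setT (EFin \o h) /\
  forall B : set E, measurable B ->
    (\int[distribution P X]_(x in B) (h x)%:E)%E = P (A `&` X @^-1` B).

(* F(y, x) = P(Y <= y | X = x), as a regular version: F(., x) is a distribution
   function for every x. *)
Definition cond_cdf (Y : {RV P >-> R}) (X : {RV P >-> E}) (F : R -> E -> R)
    : Prop :=
  (forall x, distribution_function (F ^~ x)) /\
  (forall y, cond_prob [set w | Y w <= y] X (F y)).

End conditional.

(* Z_T = o_P(1) as T -> oo; the probability space may change with T. *)
Definition oP1 (R : realType) (d : nat -> measure_display)
    (Omega : forall T, measurableType (d T)) (P : forall T, probability (Omega T) R)
    (Z : forall T, Omega T -> R) : Prop :=
  forall eps : R, 0 < eps ->
    P T [set w | eps < `|Z T w|] @[T --> \oo] --> 0%E.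

(* The times 1, ..., T+1 are the elements of 'I_T.+1, and the time T+1 is
   [ord_max]. *)
Section conformal.
Context d (Omega : measurableType d) (R : realType) (P : probability Omega R)
  (p T : nat).
Variables (Y : 'I_T.+1 -> {RV P >-> R}) (X : 'I_T.+1 -> {RV P >-> p.-tuple R}).
Variables (psi : R -> R) (F : R -> p.-tuple R -> R).
(* [Fhat z] is the estimate of F computed from the data set z. *)
Variable Fhat : ('I_T.+1 -> R * p.-tuple R) -> R -> p.-tuple R -> R.

Definition augmented (w : Omega) (y : R) (t : 'I_T.+1) : R * p.-tuple R :=
  (if t == ord_max then y else Y t w, X t w).

Definition Uhat (w : Omega) (y : R) (t : 'I_T.+1) : R :=
  Fhat (augmented w y) (augmented w y t).1 (augmented w y t).2.

Definition Vhat (w : Omega) (y : R) (t : 'I_T.+1) : R := psi (Uhat w y t).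

Definition phat (w : Omega) (y : R) : R :=
  T.+1%:R^-1 * \sum_(t < T.+1) (Vhat w y ord_max <= Vhat w y t)%R%:R.

Definition full_set (alpha : R) (w : Omega) : set R :=
  [set y | alpha < phat w y].

Definition Vtrue (t : 'I_T.+1) (w : Omega) : R := psi (F (Y t w) (X t w)).

Definition Gtilde (w : Omega) (v : R) : R :=
  T.+1%:R^-1 * \sum_(t < T.+1) (Vtrue t w < v)%R%:R.

Definition Gtrue (v : R) : R := fine (P [set w | Vtrue ord_max w <= v]).

End conformal.

(* Main.v *)
From HB Require Import structures.
Require Import Defs.
From mathcomp Require Import measurable_realfun ring lra.

(** Conditionally on X, the probability integral transform U = F(Y, X) is
    uniform on [0, 1], hence U is independent of X, and so is V = psi(U).  The
    distribution function G of V, being continuous and independent of X, is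
    therefore a conditional distribution function of V given X, and the same
    argument shows that G(V_{T+1}) is uniform and independent of X_{T+1}.
    The p-value is 1 - G(V_{T+1}) up to an error that vanishes in probability:
    by Markov's inequality for phi, few of the |Vhat_t - V_t| exceed delta, so
    the ranks of the Vhat_t are squeezed between those of V shifted by
    2 delta, which the Lipschitz function G absorbs.  Hence the coverage event
    A and B = {G(V_{T+1}) < 1 - alpha} differ by an event D of vanishing
    probability, P(B | X_{T+1}) = 1 - alpha, and comparing A with B on the sets
    {q(X) > 1 - alpha + eps} and {q(X) < 1 - alpha - eps} gives
    eps P(|q(X) - (1 - alpha)| > eps) <= 2 P(D). *)

Set Implicit Arguments.
Unset Strict Implicit.
Unset Printing Implicit Defensive.

Local Open Scope classical_set_scope.
Local Open Scope ring_scope.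

(** * Preliminaries on countable covers, measurable sets and rational approximation *)

(** Disjointifying the cover splits [B] into countably many pieces, each inside some [E k], and the
    two series of measures are compared term by term. This glues estimates that are only available
    locally. *)
Lemma le_measure_cover d (T : measurableType d) (R : realType)
    (m1 m2 : {measure set T -> \bar R}) (E : (set T)^nat) :
  (forall k, measurable (E k)) ->
  (forall k B, measurable B -> B `<=` E k -> (m1 B <= m2 B)%E) ->
  forall B, measurable B -> B `<=` \bigcup_k E k -> (m1 B <= m2 B)%E.
Proof.
move=> mE le12 B mB BE.
have mS k : measurable (seqDU E k).
  by apply: measurableD => //; exact: bigsetU_measurable.
have -> : B = \bigcup_k (B `&` seqDU E k).
  by rewrite -setI_bigcupr -seqDU_bigcup_eq setIidl.
have tB : trivIset setT (fun k => B `&` seqDU E k).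
  exact/trivIset_setIl/trivIset_seqDU.
have mBS k : measurable (B `&` seqDU E k) by exact: measurableI.
rewrite !measure_semi_bigcup //; try exact: bigcupT_measurable.
by apply: lee_nneseries => // k _; apply: (le12 k) => // x [_ []].
Qed.

Lemma measurable_ltr_set d (T : measurableType d) (R : realType) (f g : T -> R) :
  measurable_fun setT f -> measurable_fun setT g ->
  measurable [set w | f w < g w].
Proof.
move=> mf mg; have := measurable_fun_ltr mf mg measurableT (Logic.I : measurable [set true]).
by rewrite setTI.
Qed.

Lemma measurable_ler_set d (T : measurableType d) (R : realType) (f g : T -> R) :
  measurable_fun setT f -> measurable_fun setT g ->
  measurable [set w | f w <= g w].
Proof.
by move=> mf mg; have := measurable_fun_le measurableT mf mg; rewrite setTI.
Qed.

(** The intermediate value theorem produces a point with value [(a + b) / 2]; the preimage of the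
    open interval is then open and non-empty, so it meets the rationals. Rational thresholds keep
    later covers countable. *)
Lemma distribution_function_rat_between (R : realType) (f : R -> R) (a b : R) :
  distribution_function f -> continuous f -> 0 <= a -> a < b -> b <= 1 ->
  exists r : rat, a < f (ratr r) < b.
Proof.
move=> [ndf _ fNy fy] cf a0 ab b1; pose c := (a + b) / 2.
have c0 : 0 < c by rewrite /c; lra.
have c1 : c < 1 by rewrite /c; lra.
have [y1 y1c] : exists y, f y < c.
  exact: (@filter_ex _ _ _ _ (cvgr_lt 0 fNy c c0)).
have [y2 y2c] : exists y, c < f y.
  exact: (@filter_ex _ _ _ _ (cvgr_gt 1 fy c c1)).
have y12 : y1 <= y2.
  by rewrite leNgt; apply/negP => /ltW/ndf; rewrite leNgt (lt_trans y1c y2c).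
have [y _ fyc] : exists2 y, y \in `[y1, y2] & f y = c.
  apply: IVT => //; first exact: continuous_subspaceT.
  by rewrite ge_min le_max (ltW y1c) (ltW y2c) orbT.
have ofab : open (f @^-1` `]a, b[).
  by apply: open_comp => [x _|]; [exact: cf|exact: interval_open].
have fab0 : (f @^-1` `]a, b[) !=set0.
  by exists y; rewrite /= in_itv/= fyc /c; apply/andP; split; lra.
have [x [/= fx [r _ rx]]] := dense_rat fab0 ofab.
by exists r; rewrite rx; move: fx; rewrite in_itv.
Qed.

Lemma right_continuous_lt_rat (R : realType) (f : R -> R) y u :
  right_continuous f -> f y < u -> exists r : rat, y < ratr r /\ f (ratr r) < u.
Proof.
move=> rf fyu.
have [/= e e0 fe] : \forall x \near y^'+, f x < u by apply: cvgr_lt (rf y) _ fyu.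
have [r] := @rat_in_itvoo R y (y + e) ltac:(by rewrite ltrDl).
rewrite in_itv/= => /andP[yr rye]; exists r; split => //; apply: fe => //=.
by rewrite ltr0_norm ?subr_lt0// opprB ltrBlDl.
Qed.

(** * Image measures restricted to an event *)

Section joint_measure.
Context d d' (T : measurableType d) (T' : measurableType d') (R : realType)
  (mu : {measure set T -> \bar R}).
Variables (A : set T) (f : T -> T').

(* The measurability proofs are dummy arguments from which the measure structure
   is inferred. *)
Definition joint_measure of measurable A & measurable_fun setT f :=
  fun C : set T' => mu (A `&` f @^-1` C).

Variables (mA : measurable A) (mf : measurable_fun setT f).
Local Notation nu := (joint_measure mA mf).

Let mpre C : measurable C -> measurable (f @^-1` C).
Proof. by move=> mC; rewrite -[X in measurable X]setTI; exact: mf. Qed.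

Let nu0 : nu set0 = 0%E.
Proof. by rewrite /joint_measure preimage_set0 setI0 measure0. Qed.

Let nu_ge0 C : (0 <= nu C)%E.
Proof. exact: measure_ge0. Qed.

Let nu_sigma_additive : semi_sigma_additive nu.
Proof.
move=> B mB tB mUB; rewrite /joint_measure preimage_bigcup setI_bigcupr.
apply: measure_semi_sigma_additive.
- by move=> n; apply: measurableI => //; exact: mpre.
- apply/trivIset_setIl/trivIsetP => i j _ _ ij.
  by rewrite -preimage_setI; move/trivIsetP : tB => ->//; rewrite preimage_set0.
- apply: bigcupT_measurable => n.
  by apply: measurableI => //; exact: mpre.
Qed.

HB.instance Definition _ := isMeasure.Build _ _ _ nu nu0 nu_ge0 nu_sigma_additive.

End joint_measure.

(** * Conditional probability integral transform *)

Lemma distribution_function_ge0 (R : realType) (f : R -> R) y :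
  distribution_function f -> 0 <= f y.
Proof.
move=> [ndf _ fNy _]; rewrite leNgt; apply/negP => fy0.
have [z [/ndf zy]] : exists z, z <= y /\ f y < f z.
  apply: (@filter_ex _ -oo); near=> z; split.
    near: z; apply: nbhs_ninfty_le; exact: num_real.
  by near: z; exact: (cvgr_gt 0 fNy).
by rewrite ltNge zy.
Unshelve. all: by end_near. Qed.

Lemma distribution_function_le1 (R : realType) (f : R -> R) y :
  distribution_function f -> f y <= 1.
Proof.
move=> [ndf _ _ f1]; rewrite leNgt; apply/negP => fy1.
have [z [/ndf zy]] : exists z, y <= z /\ f z < f y.
  apply: (@filter_ex _ +oo); near=> z; split.
    near: z; apply: nbhs_pinfty_ge; exact: num_real.
  by near: z; exact: (cvgr_lt 1 f1).
by rewrite ltNge zy.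
Unshelve. all: by end_near. Qed.

Section pit.
Context d d' (Omega : measurableType d) (E : measurableType d') (R : realType)
  (P : probability Omega R) (Y : {RV P >-> R}) (X : {RV P >-> E})
  (F : R -> E -> R).
Hypothesis hF : cond_cdf Y X F.

Lemma cond_cdf_measurable y : measurable_fun setT (F y).
Proof. by have [[/measurable_int/measurable_EFinP]] := hF.2 y. Qed.

(** [F] is only known to be measurable in [x] for each fixed [y]. Right continuity allows [Y w] to
    be replaced by a rational above it, and monotonicity gives the converse, so measurability of
    F(Y, X) follows from a countable union. *)
Lemma pit_lt_bigcup u : [set w | F (Y w) (X w) < u] =
  \bigcup_(r : rat) ([set w | Y w <= ratr r] `&` [set w | F (ratr r) (X w) < u]).
Proof.
apply/seteqP; split => [w /= Fu|w [r _ [/= Yr]]].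
  by have [_ rF _ _] := hF.1 (X w); have [r [/ltW Yr Fr]] := right_continuous_lt_rat rF Fu; exists r.
by apply: le_lt_trans; have [+ _ _ _] := hF.1 (X w); exact.
Qed.

Lemma measurable_pit : measurable_fun setT (fun w => F (Y w) (X w)).
Proof.
apply: (measurability (@RGenInftyO.G R)).
  exact: RGenInftyO.measurableE.
move=> _ [_ [u ->] <-]; rewrite setTI.
rewrite (_ : _ @^-1` _ = [set w | F (Y w) (X w) < u]); last first.
  by apply/seteqP; split => w /=; rewrite in_itv.
rewrite pit_lt_bigcup; apply: bigcupT_measurable_rat => r.
apply: measurableI; first exact: measurable_ler_set.
apply: measurable_ltr_set => //.
exact: measurableT_comp (cond_cdf_measurable _) _.
Qed.

Hypothesis cF : {ae P, forall w, continuous (F ^~ (X w))}.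

Let mX C : measurable C -> measurable (X @^-1` C).
Proof. by move=> mC; exact: measurable_funPTI. Qed.

Let mU_lt b : measurable [set w | F (Y w) (X w) < b].
Proof. by apply: measurable_ltr_set => //; exact: measurable_pit. Qed.

Let mU_le a : measurable [set w | F (Y w) (X w) <= a].
Proof. by apply: measurable_ler_set => //; exact: measurable_pit. Qed.

Section pit_bounds.
Variables a b : R.
Hypotheses (a0 : 0 <= a) (ab : a < b) (b1 : b <= 1).

(* For x in S k, Y <= r_k forces U < b and Y > r_k forces U > a. *)
Let r_ k : R := ratr (odflt 0 (unpickle k)).
Let S k := [set x | a < F (r_ k) x < b].

Let mS k : measurable (S k).
Proof.
have -> : S k = [set x | a < F (r_ k) x] `&` [set x | F (r_ k) x < b].
  by apply/seteqP; split => x /=; [move=> /andP|move=> /andP].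
by apply: measurableI; apply: measurable_ltr_set => //; exact: cond_cdf_measurable.
Qed.

(** Wherever F(., X w) is continuous, it takes a value strictly between [a] and [b] at some
    rational, so the sets [S k] cover almost every value of [X]. *)
Let PS : P (X @^-1` ~` \bigcup_k S k) = 0%E.
Proof.
apply/negligibleP; first exact/mX/measurableC/bigcupT_measurable.
apply: (negligibleS _ cF) => w /= nS cw; apply: nS.
have [q q_ab] := distribution_function_rat_between (hF.1 (X w)) cw a0 ab b1.
(* Every rational is some [r_ k]; indices that encode no rational only repeat the threshold 0. *)
by exists (pickle q) => //; rewrite /S/= /r_ pickleK.
Qed.

Let PIS A C : measurable A -> measurable C ->
  P (A `&` X @^-1` C) = P (A `&` X @^-1` (C `&` \bigcup_k S k)).
Proof.
move=> mA mC; have mD := bigcupT_measurable _ mS.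
rewrite (measureDI P (measurableI _ _ mA (mX mC)) (mX mD)).
rewrite [X in (X + _)%E](_ : _ = 0%E) ?add0e; last first.
  apply/eqP; rewrite -measure_le0 -PS; apply: le_measure; rewrite ?inE.
  - by apply: measurableD; [apply: measurableI => //|]; exact: mX.
  - exact/mX/measurableC.
  - by move=> w [].
by rewrite preimage_setI setIA.
Qed.

(** The middle probability is the integral of F(r_k, .) over [C], and on [S k] this integrand lies
    between [a] and [b]. *)
Let le_int k C : measurable C -> C `<=` S k ->
  (a%:E * P (X @^-1` C) <= P ([set w | (Y w <= r_ k)%R] `&` X @^-1` C))%E /\
  (P ([set w | (Y w <= r_ k)%R] `&` X @^-1` C) <= b%:E * P (X @^-1` C))%E.
Proof.
move=> mC CS; rewrite -(hF.2 (r_ k)).2 //.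
have mFk : measurable_fun C (EFin \o F (r_ k)).
  apply/measurable_EFinP; apply: measurable_funTS; exact: cond_cdf_measurable.
have F0 x : C x -> (0 <= (F (r_ k) x)%:E)%E.
  by move=> /CS /andP[/ltW + _]; rewrite lee_fin; exact: le_trans.
split.
  rewrite -(integral_cst (distribution P X) mC a%:E).
  by apply: ge0_le_integral => // x Cx; rewrite ?lee_fin//=; case/CS/andP : Cx => /ltW.
rewrite -(integral_cst (distribution P X) mC b%:E).
apply: ge0_le_integral => // x Cx; rewrite lee_fin.
by case/CS/andP : Cx => _ /ltW.
Qed.

(** Both sides are measures in [C], so by the cover lemma it suffices to treat subsets of one [S k].
    There Y <= r_k implies U <= F(r_k, X) < b, and the lower bound of [le_int] applies. *)
Lemma pit_lt_ge C : measurable C ->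
  (a%:E * P (X @^-1` C) <= P ([set w | (F (Y w) (X w) < b)%R] `&` X @^-1` C))%E.
Proof.
move=> mC; have mD := bigcupT_measurable _ mS.
rewrite -[X in (_ * P X)%E]setTI (PIS measurableT mC) setTI (PIS (mU_lt b) mC).
apply: (@le_measure_cover _ _ _ (mscale (NngNum a0) (distribution P X))
  (joint_measure P (mU_lt b) (measurable_funPT X)) S) => //.
- move=> k B mB BS; apply: le_trans (le_int mB BS).1 _.
  apply: le_measure; rewrite ?inE; first exact: measurableI (measurable_ler_set _ _) (mX mB).
    exact: measurableI (mU_lt _) (mX mB).
  move=> w [/= Yr Bw]; split => //=.
  have /andP[_] := BS _ Bw; apply: le_lt_trans.
  by have [+ _ _ _] := hF.1 (X w); exact.
- exact: measurableI.
Qed.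

(** Dual argument: on [S k], r_k <= Y would give a < F(r_k, X) <= U, so U <= a forces Y <= r_k and
    the upper bound of [le_int] applies. *)
Lemma pit_le_le C : measurable C ->
  (P ([set w | (F (Y w) (X w) <= a)%R] `&` X @^-1` C) <= b%:E * P (X @^-1` C))%E.
Proof.
move=> mC; have mD := bigcupT_measurable _ mS.
rewrite -[X in (_ * P X)%E]setTI (PIS measurableT mC) setTI (PIS (mU_le a) mC).
have b0 : 0 <= b by rewrite (le_trans a0)// ltW.
apply: (@le_measure_cover _ _ _
  (joint_measure P (mU_le a) (measurable_funPT X))
  (mscale (NngNum b0) (distribution P X)) S) => //.
- move=> k B mB BS; apply: le_trans _ (le_int mB BS).2.
  apply: le_measure; rewrite ?inE; first exact: measurableI (mU_le _) (mX mB).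
    exact: measurableI (measurable_ler_set _ _) (mX mB).
  move=> w [/= Fa Bw]; split => //=.
  rewrite leNgt; apply/negP => /ltW rY.
  have /andP[+ _] := BS _ Bw; rewrite ltNge => /negP; apply.
  by apply: le_trans Fa; have [+ _ _ _] := hF.1 (X w); exact.
- exact: measurableI.
Qed.

End pit_bounds.

(** The two bounds, used on intervals of length at most [e] just below and just above [u], squeeze
    both probabilities to u P(X in C) as [e] tends to 0. *)
Lemma pit_lt_le u C : 0 <= u <= 1 -> measurable C ->
  P ([set w | F (Y w) (X w) < u] `&` X @^-1` C) = (u%:E * P (X @^-1` C))%E /\
  P ([set w | F (Y w) (X w) <= u] `&` X @^-1` C) = (u%:E * P (X @^-1` C))%E.
Proof.
move=> /andP[u0 u1] mC.
have mlt : measurable ([set w | F (Y w) (X w) < u] `&` X @^-1` C).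
  by apply: measurableI => //; exact: mX.
have mle : measurable ([set w | F (Y w) (X w) <= u] `&` X @^-1` C).
  by apply: measurableI => //; exact: mX.
have lt_le : (P ([set w | (F (Y w) (X w) < u)%R] `&` X @^-1` C) <=
              P ([set w | (F (Y w) (X w) <= u)%R] `&` X @^-1` C))%E.
  by apply: le_measure; rewrite ?inE// => w [/ltW Uu Cw].
have finP A : measurable A -> exists r, P A = r%:E.
  by move=> mA; exists (fine (P A)); rewrite fineK// fin_num_measure.
have [p Ep] := finP _ (mX mC).
have [s Es] := finP _ mlt.
have [t Et] := finP _ mle.
have p1 : p <= 1 by rewrite -lee_fin -Ep probability_le1//; exact: mX.
have p0 : 0 <= p by rewrite -lee_fin -Ep.
have s0 : 0 <= s by rewrite -lee_fin -Es.
have lower : u * p <= s.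
  apply/ler_addgt0Pr => e e0.
  (* If u <= e the interval would leave [0, 1], but then u p <= e and the claim is trivial. *)
  have [ue|eu] := leP u e; first nra.
  have := @pit_lt_ge (u - e) u _ _ u1 C mC; rewrite Ep Es -EFinM lee_fin.
  by move=> /(_ ltac:(lra) ltac:(lra)); nra.
have upper : t <= u * p.
  (* At u = 1 there is no room above [u], and monotonicity of [P] suffices. *)
  move: u1; rewrite le_eqVlt => /predU1P[u1|u1].
    by rewrite u1 mul1r -lee_fin -Et -Ep le_measure ?inE//; exact: mX.
  apply/ler_addgt0Pr => e e0.
  have := @pit_le_le u (Num.min 1 (u + e)) u0 _ _ C mC.
  rewrite Ep Et -EFinM lee_fin ge_min lexx lt_min u1 ltrDl e0 => /(_ isT isT).
  have : Num.min 1 (u + e) <= u + e by rewrite ge_min lexx orbT.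
  nra.
move: lt_le; rewrite Ep Es Et -EFinM lee_fin => st.
by split; congr EFin; apply/eqP; rewrite eq_le ?upper ?lower ?(le_trans st)// (le_trans lower).
Qed.

(** For fixed [C], both sides are finite measures in [S]. They agree on the rays ]-oo, u[, which
    form a generating pi-system, hence everywhere. *)
Lemma pit_indep (S : set R) (C : set E) : measurable S -> measurable C ->
  P ([set w | S (F (Y w) (X w))] `&` X @^-1` C) =
  (P [set w | S (F (Y w) (X w))] * P (X @^-1` C))%E.
Proof.
move=> mS mC; have mU := measurable_pit.
have p0 : 0 <= fine (P (X @^-1` C)) by exact: fine_ge0.
pose m1 : {measure set R -> \bar R} := joint_measure P (mX mC) mU.
pose m2 : {measure set R -> \bar R} :=
  mscale (NngNum p0) (joint_measure P measurableT mU).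
suff : m1 S = m2 S.
  rewrite /m1 /m2 /= /mscale /joint_measure /= setTI setIC => ->.
  by rewrite fineK ?fin_num_measure// 1?muleC//; exact: mX.
apply: (measure_unique (@RGenInftyO.G R) (fun n => `]-oo, n%:R[%classic)) => //.
- exact: RGenInftyO.measurableE.
- move=> _ _ [x ->] [y ->]; exists (Num.min x y).
  by apply/seteqP; split => z /=; rewrite !in_itv/= lt_min; move/andP.
- by move=> n; exists n%:R.
- rewrite -subTset => x _; exists (Num.truncn `|x|).+1 => //=.
  by rewrite in_itv/= (le_lt_trans (ler_norm x))// Num.Theory.truncnS_gt.
- move=> _ [u ->]; rewrite /m1 /m2 /= /mscale /joint_measure /= setTI setIC.
  rewrite fineK ?fin_num_measure//; last exact: mX.
  rewrite (_ : _ @^-1` `]-oo, u[ = [set w | F (Y w) (X w) < u]); last first.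
    by apply/seteqP; split => w /=; rewrite in_itv.
  (* For [u] outside [0, 1] the event is empty or everything, since U takes values in [0, 1]. *)
  have [u0|u0] := ltP u 0.
    rewrite (_ : [set w | _] = set0) ?set0I ?measure0 ?mule0//.
    rewrite -subset0 => w /=; apply/negP; rewrite -leNgt ltW// (lt_le_trans u0)//.
    exact: distribution_function_ge0 (hF.1 (X w)).
  have [u1|u1] := leP u 1.
    have u01 : 0 <= u <= 1 by rewrite u0.
    have := (pit_lt_le u01 measurableT).1.
    rewrite preimage_setT setIT probability_setT mule1 => ->.
    by rewrite (pit_lt_le u01 mC).1 muleC.
  rewrite (_ : [set w | _] = setT) ?setTI ?probability_setT ?mule1//.
  rewrite -subTset => w _ /=; rewrite (le_lt_trans _ u1)//.
  exact: distribution_function_le1 (hF.1 (X w)).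
- move=> k; rewrite /m1 /= /joint_measure.
  rewrite (le_lt_trans (probability_le1 P _)) ?ltry//.
  apply: measurableI; first exact: mX.
  by rewrite -[X in measurable X]setTI; exact: measurable_pit.
Qed.

End pit.

(** * Second transform, applied to the score V = psi(U) *)

Lemma distribution_function_cdf d (T : measurableType d) (R : realType)
    (P : probability T R) (V : {RV P >-> R}) :
  distribution_function (fun v => fine (P [set w | V w <= v])).
Proof.
have -> : (fun v => fine (P [set w | V w <= v])) = fine \o cdf V.
  by apply/funext => v; congr (fine (P _)).
split.
- by move=> r s rs; rewrite /= fine_le ?fin_num_measure// cdf_nondecreasing.
- move=> a; apply: fine_cvg.
  by rewrite fineK ?fin_num_measure//; exact: cdf_right_continuous.
- exact/fine_cvg/cvg_cdfNy0.
- exact/fine_cvg/cvg_cdfy1.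
Qed.

Section pit_pit.
Context d d' (Omega : measurableType d) (E : measurableType d') (R : realType)
  (P : probability Omega R) (Y : {RV P >-> R}) (X : {RV P >-> E})
  (F : R -> E -> R) (psi : R -> R).
Hypothesis hF : cond_cdf Y X F.
Hypothesis cF : {ae P, forall w, continuous (F ^~ (X w))}.
Hypothesis mpsi : measurable_fun setT psi.

Let V w := psi (F (Y w) (X w)).
Let G v := fine (P [set w | V w <= v]).

Lemma measurable_psi_pit : measurable_fun setT V.
Proof. exact: measurableT_comp mpsi (measurable_pit hF). Qed.

#[local] HB.instance Definition _ := isMeasurableFun.Build _ _ _ _ V measurable_psi_pit.

(** V is a function of U alone, so it is independent of [X] and its conditional distribution
    function does not depend on [x]. Casting this as a [cond_cdf] lets the transform be applied a
    second time. *)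
Lemma cond_cdf_psi_pit : cond_cdf (V : {RV P >-> R}) X (fun v _ => G v).
Proof.
split=> [_|v]; first exact: distribution_function_cdf.
split; first exact: finite_measure_integrable_cst.
move=> B mB; rewrite integral_cst// fineK; last first.
  by rewrite fin_num_measure//; exact: measurable_ler_set.
have mS : measurable [set u | psi u <= v] by exact: measurable_ler_set.
by rewrite -(pit_indep hF cF mS mB).
Qed.

Lemma cdf_psi_pit_lt u C : continuous G -> 0 <= u <= 1 -> measurable C ->
  P ([set w | G (V w) < u] `&` X @^-1` C) = (u%:E * P (X @^-1` C))%E.
Proof.
move=> cG u01 mC.
by rewrite (pit_lt_le cond_cdf_psi_pit _ u01 mC).1//; exact: aeW.
Qed.

End pit_pit.

(** * Stability of empirical ranks *)

Lemma ler_mean (R : realType) n (f g : 'I_n.+1 -> R) : (forall t, f t <= g t) ->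
  n.+1%:R^-1 * (\sum_(t < n.+1) f t) <= n.+1%:R^-1 * (\sum_(t < n.+1) g t).
Proof.
by move=> fg; rewrite ler_pM2l ?invr_gt0 ?ltr0n//; apply: ler_sum => t _.
Qed.

(** The weights [c] dominate the indicators of errors larger than [delta], so at most a proportion
    [kappa] of indices is bad. For the others, V t < V o - 2 delta implies Vh t < Vh o, which
    implies V t < V o + 2 delta. Replacing the empirical function by [G] costs another [kappa], and
    undoing the shift costs 2 L delta. *)
Lemma rank_perturbation (R : realType) n (V Vh c : 'I_n.+1 -> R) (o : 'I_n.+1)
    (G : R -> R) (L delta kappa : R) :
  (forall t, 0 <= c t) -> (forall t, delta < `|Vh t - V t| -> 1 <= c t) ->
  n.+1%:R^-1 * (\sum_(t < n.+1) c t) <= kappa ->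
  `|Vh o - V o| <= delta ->
  (forall v, `|n.+1%:R^-1 * (\sum_(t < n.+1) (V t < v)%R%:R) - G v| <= kappa) ->
  (forall x y, `|G x - G y| <= L * `|x - y|) ->
  `|n.+1%:R^-1 * (\sum_(t < n.+1) (Vh o <= Vh t)%R%:R) - (1 - G (V o))|
    <= 2 * kappa + 2 * L * delta.
Proof.
move=> c0 c1 ck ho hG lipG.
have d0 : 0 <= delta by rewrite (le_trans _ ho).
have n0 : n.+1%:R != 0 :> R by rewrite pnatr_eq0.
set lo : R := n.+1%:R^-1 * (\sum_(t < n.+1) (V t < V o - 2 * delta)%R%:R).
set up : R := n.+1%:R^-1 * (\sum_(t < n.+1) (V t < V o + 2 * delta)%R%:R).
set m : R := n.+1%:R^-1 * (\sum_(t < n.+1) (Vh t < Vh o)%R%:R).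
set s : R := n.+1%:R^-1 * (\sum_(t < n.+1) c t) in ck *.
(* The p-value is the complement of the strict rank [m], which is what [lo] and [up] bracket. *)
have -> : n.+1%:R^-1 * (\sum_(t < n.+1) (Vh o <= Vh t)%R%:R) = 1 - m.
  apply/eqP; rewrite eq_sym subr_eq -mulrDr -big_split/=.
  rewrite (eq_bigr (fun=> 1)) => [|t _]; last first.
    by rewrite leNgt; case: ltP => _; rewrite ?add0r ?addr0.
  by rewrite sumr_const card_ord mulVf.
(* Termwise: a good index is covered by the shifted indicator, a bad one by c t >= 1. *)
have m_up : m <= up + s.
  rewrite -mulrDr -big_split/=; apply: ler_mean => t.
  have ct := c0 t; have [hd|/c1 ?] := leP `|Vh t - V t| delta.
    move: ho hd; rewrite !ler_norml => /andP[? ?] /andP[? ?].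
    by case: (ltP (Vh t)) => /= ?; case: ltP => /= ?; lra.
  by case: (ltP (Vh t)) => /= ?; case: ltP => /= ?; lra.
have lo_m : lo <= m + s.
  rewrite -mulrDr -big_split/=; apply: ler_mean => t.
  have ct := c0 t; have [hd|/c1 ?] := leP `|Vh t - V t| delta.
    move: ho hd; rewrite !ler_norml => /andP[? ?] /andP[? ?].
    by case: (ltP (Vh t)) => /= ?; case: ltP => /= ?; lra.
  by case: (ltP (Vh t)) => /= ?; case: ltP => /= ?; lra.
have h1 := hG (V o + 2 * delta); have h2 := hG (V o - 2 * delta).
have h3 := lipG (V o + 2 * delta) (V o); have h4 := lipG (V o - 2 * delta) (V o).
move: h1 h2 h3 h4; rewrite -/lo -/up.
rewrite (_ : V o + 2 * delta - V o = 2 * delta); last by ring.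
rewrite (_ : V o - 2 * delta - V o = - (2 * delta)); last by ring.
rewrite normrN (ger0_norm (_ : 0 <= 2 * delta)) ?mulr_ge0// !ler_norml.
move=> /andP[? ?] /andP[? ?] /andP[? ?] /andP[? ?]; apply/andP; split; lra.
Qed.

(** * Conditional probabilities of events close to an event independent of X *)

Section cond_prob_near_constant.
Context d d' (Omega : measurableType d) (E : measurableType d') (R : realType)
  (P : probability Omega R) (X : {RV P >-> E}).
Variables (A B D : set Omega) (q : E -> R) (c eps : R).
Hypotheses (mA : measurable A) (mB : measurable B) (mD : measurable D).
Hypothesis qA : cond_prob A X q.
Hypothesis cB : forall C, measurable C ->
  P (B `&` X @^-1` C) = (c%:E * P (X @^-1` C))%E.
Hypotheses (AB : A `<=` B `|` D) (BA : B `<=` A `|` D).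

Let mX C : measurable C -> measurable (X @^-1` C).
Proof. by move=> mC; exact: measurable_funPTI. Qed.

Let le_event A1 A2 C : measurable A1 -> measurable A2 -> measurable C ->
  A1 `<=` A2 `|` D ->
  (P (A1 `&` X @^-1` C) <= P (A2 `&` X @^-1` C) + P D)%E.
Proof.
move=> mA1 mA2 mC A12.
apply: le_trans (measureU2 _ (measurableI _ _ mA2 (mX mC)) mD).
apply: le_measure; rewrite ?inE.
- by apply: measurableI => //; exact: mX.
- by apply: measurableU => //; apply: measurableI => //; exact: mX.
- by move=> w [/A12 [?|?] ?]; [left|right].
Qed.

Let fin_event A1 : measurable A1 -> exists r, P A1 = r%:E.
Proof. by move=> mA1; exists (fine (P A1)); rewrite fineK// fin_num_measure. Qed.

Let mq : measurable_fun setT q.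
Proof. by have [/measurable_int/measurable_EFinP] := qA. Qed.

Let int_q C : measurable C -> (distribution P X).-integrable C (EFin \o q).
Proof. by move=> mC; apply: integrableS qA.1. Qed.

Let int_cst r C : measurable C -> (distribution P X).-integrable C (EFin \o cst r).
Proof. by move=> mC; exact: finite_measure_integrable_cst. Qed.

(** With C = {q > c + eps}, (c + eps) P(X in C) <= P(A, X in C) <= P(B, X in C) + P(D) = c P(X in C)
    + P(D); then cancel. *)
Lemma cond_prob_above :
  (eps%:E * P [set w | (c + eps < q (X w))%R] <= P D)%E.
Proof.
pose C := [set x | c + eps < q x]; have mC : measurable C by exact: measurable_ltr_set.
have le1 : ((c + eps)%:E * P (X @^-1` C) <= P (A `&` X @^-1` C))%E.
  rewrite -qA.2// -(integral_cst (distribution P X) mC (c + eps)%:E).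
  by apply: le_integral => //; [exact: int_cst|exact: int_q|move=> x; rewrite inE lee_fin; exact: ltW].
have := le_event mA mB mC AB; rewrite cB//.
rewrite -[[set w | _]]/(X @^-1` C).
have [p Ep] := fin_event (mX mC); have [r Er] := fin_event mD.
have [s Es] := fin_event (measurableI _ _ mA (mX mC)).
by move: le1; rewrite Ep Er Es -!EFinM -EFinD !lee_fin; lra.
Qed.

(** The same chain on {q < c - eps}, with the roles of [A] and [B] exchanged. *)
Lemma cond_prob_below :
  (eps%:E * P [set w | (q (X w) < c - eps)%R] <= P D)%E.
Proof.
pose C := [set x | q x < c - eps]; have mC : measurable C by exact: measurable_ltr_set.
have le1 : (P (A `&` X @^-1` C) <= (c - eps)%:E * P (X @^-1` C))%E.
  rewrite -qA.2// -(integral_cst (distribution P X) mC (c - eps)%:E).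
  by apply: le_integral => //; [exact: int_q|exact: int_cst|move=> x; rewrite inE lee_fin; exact: ltW].
have := le_event mB mA mC BA; rewrite cB//.
rewrite -[[set w | _]]/(X @^-1` C).
have [p Ep] := fin_event (mX mC); have [r Er] := fin_event mD.
have [s Es] := fin_event (measurableI _ _ mA (mX mC)).
by move: le1; rewrite Ep Er Es -!EFinM -EFinD !lee_fin; lra.
Qed.

Lemma cond_prob_near_cst : 0 < eps ->
  (eps%:E * P [set w | (eps < `|q (X w) - c|)%R] <= 2%:E * P D)%E.
Proof.
move=> eps0; have mqX : measurable_fun setT (fun w => q (X w)) by exact: measurableT_comp mq _.
have m1 : measurable [set w | c + eps < q (X w)] by exact: measurable_ltr_set.
have m2 : measurable [set w | q (X w) < c - eps] by exact: measurable_ltr_set.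
have -> : [set w | eps < `|q (X w) - c|] =
    [set w | c + eps < q (X w)] `|` [set w | q (X w) < c - eps].
  apply/seteqP; split => w /=; rewrite lter_normr => h.
    by case/orP: h => h; [left|right]; lra.
  by apply/orP; case: h => h; [left|right]; lra.
have := cond_prob_above; have := cond_prob_below.
have : (P ([set w | (c + eps < q (X w))%R] `|` [set w | (q (X w) < c - eps)%R]) <=
    P [set w | (c + eps < q (X w))%R] + P [set w | (q (X w) < c - eps)%R])%E.
  exact: measureU2.
have [r1 E1] := fin_event m1; have [r2 E2] := fin_event m2.
have [r3 E3] := fin_event (measurableU _ _ m1 m2); have [r Er] := fin_event mD.
by rewrite E1 E2 E3 Er -!EFinM -EFinD !lee_fin; nra.
Qed.

End cond_prob_near_constant.

(** * Measurability of the uniform deviation of the empirical distribution function *)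

Section empirical_cdf.
Context (R : realType) (n : nat).
Implicit Types (V : 'I_n.+1 -> R) (G : R -> R).

(** The strict inequality makes this version left-continuous, so rational approximation must come
    from the left. *)
Definition ecdf V v : R := n.+1%:R^-1 * \sum_(t < n.+1) (V t < v)%R%:R.

Lemma ecdf_ge0 V v : 0 <= ecdf V v.
Proof. by rewrite mulr_ge0 ?invr_ge0// sumr_ge0. Qed.

Lemma ecdf_le1 V v : ecdf V v <= 1.
Proof.
rewrite (le_trans (@ler_mean _ _ _ (fun=> 1) _)) => [//|t|]; first by case: ltP.
by rewrite sumr_const card_ord mulVf ?pnatr_eq0.
Qed.

(** Boundedness ensures that the real-valued [sup] is a genuine least upper bound here. *)
Lemma has_sup_ecdf V G : (forall v, 0 <= G v <= 1) ->
  has_sup (range (fun v => `|ecdf V v - G v|)).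
Proof.
move=> G01; split; first by exists `|ecdf V 0 - G 0|; exists 0.
exists 1 => _ [v _ <-]; have := ecdf_ge0 V v; have := ecdf_le1 V v.
by have /andP[] := G01 v; rewrite ler_norml => *; apply/andP; split; lra.
Qed.

Lemma ecdf_near_left V v : \forall r \near v^'-, ecdf V r = ecdf V v.
Proof.
have : \forall r \near v^'-, forall t, (V t < r) = (V t < v).
  apply: filter_forall => t; case: (ltP (V t) v) => [Vv|vV].
    have := nbhs_left_gt Vv; exact: filterS.
  have := nbhs_left_lt v; apply: filterS => r rv.
  by rewrite ltNge (le_trans (ltW rv)).
by apply: filterS => r Vr; rewrite /ecdf; under eq_bigr do rewrite Vr.
Qed.

(** Just left of [v] the step function keeps its value and [G] varies little, so a strict excess at
    [v] persists at a nearby rational. Hence {sup > e} is a countable union of events. *)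
Lemma ecdf_dist_gt_rat V G v e : continuous G -> e < `|ecdf V v - G v| ->
  exists r : rat, e < `|ecdf V (ratr r) - G (ratr r)|.
Proof.
move=> cG ev.
have Gv : (fun r => `|ecdf V v - G r|) r @[r --> v^'-] --> `|ecdf V v - G v|.
  by apply: cvg_norm; apply: cvgB; [exact: cvg_cst|exact/cvg_at_left_filter/cG].
have [/= d d0 near_d] : \forall r \near v^'-,
    ecdf V r = ecdf V v /\ e < `|ecdf V v - G r|.
  by apply: filterI; [exact: ecdf_near_left|exact: (cvgr_gt _ Gv)].
have [r] := @rat_in_itvoo R (v - d) v ltac:(by rewrite ltrBlDr ltrDl).
rewrite in_itv/= => /andP[vdr rv]; exists r.
have [|//|-> //] := near_d (ratr r).
by rewrite /= gtr0_norm ?subr_gt0//; lra.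
Qed.

Lemma measurable_sup_ecdf d (Omega : measurableType d) (V : 'I_n.+1 -> Omega -> R) G :
  (forall t, measurable_fun setT (V t)) -> continuous G ->
  (forall v, 0 <= G v <= 1) ->
  measurable_fun setT
    (fun w => sup (range (fun v => `|ecdf (V ^~ w) v - G v|))).
Proof.
move=> mV cG G01.
apply: (measurability (@RGenOInfty.G R)); first exact: RGenOInfty.measurableE.
move=> _ [_ [e ->] <-]; rewrite setTI.
have -> : (fun w => sup (range (fun v => `|ecdf (V ^~ w) v - G v|))) @^-1` `]e, +oo[ =
    \bigcup_(r : rat) [set w | e < `|ecdf (V ^~ w) (ratr r) - G (ratr r)|].
  apply/seteqP; split => [w|w [r _ er]] /=; rewrite in_itv/= andbT.
    move=> /(sup_gt (has_sup_ecdf (V ^~ w) G01).1) [_ [v _ <-]].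
    by move=> /(ecdf_dist_gt_rat cG) [r er]; exists r.
  by apply: (lt_le_trans er); apply: sup_upper_bound; [exact: has_sup_ecdf|exists (ratr r)].
apply: bigcupT_measurable_rat => r; apply: measurable_ltr_set => //.
apply: measurableT_comp => //; apply: measurable_funB => //.
apply: measurable_funM => //; apply: measurable_sum => t.
by apply: measurableT_comp => //; exact: measurable_fun_ltr.
Qed.

End empirical_cdf.

(* Monotonicity on [0, +oo[ suffices: truncating at 0 makes phi monotone on R. *)
Lemma measurable_comp_normr d (T : measurableType d) (R : realType)
    (phi : R -> R) (f : T -> R) :
  {in `[0, +oo[ &, {homo phi : x y / x < y}} -> measurable_fun setT f ->
  measurable_fun setT (fun w => phi `|f w|).
Proof.
move=> iphi mf.
have mphi : measurable_fun setT (fun x : R => phi (Num.max 0 x)).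
  apply: nondecreasing_measurable => // x y xy.
  have : Num.max 0 x <= Num.max 0 y by rewrite ge_max !le_max lexx xy orbT.
  rewrite le_eqVlt => /predU1P[-> //|h]; apply/ltW/iphi => //;
    by rewrite in_itv/= andbT le_max lexx.
rewrite (_ : (fun w => _) = (fun x : R => phi (Num.max 0 x)) \o (fun w => `|f w|)).
  by apply: measurableT_comp => //; exact: measurableT_comp.
by apply/funext => w /=; rewrite max_r.
Qed.

(** * Coverage bound for a fixed sample size *)

Section coverage.
Context d (Omega : measurableType d) (R : realType) (P : probability Omega R)
  (p T : nat).
Variables (Y : 'I_T.+1 -> {RV P >-> R}) (X : 'I_T.+1 -> {RV P >-> p.-tuple R}).
Variables (psi : R -> R) (F : R -> p.-tuple R -> R).
Variable Fhat : ('I_T.+1 -> R * p.-tuple R) -> R -> p.-tuple R -> R.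
Variables (phi : R -> R) (L alpha : R).

Let V t w := Vtrue Y X psi F t w.
Let Vh t w := Vhat Y X psi Fhat w (Y ord_max w) t.
Let G := Gtrue Y X psi F.

Hypothesis hF : forall t, cond_cdf (Y t) (X t) F.
Hypothesis cF : forall t, {ae P, forall w, continuous (F ^~ (X t w))}.
Hypothesis mpsi : measurable_fun [set: R] psi.
Hypothesis mUh : forall t, measurable_fun [set: Omega]
  (fun w => Uhat Y X Fhat w (Y ord_max w) t).
Hypothesis phi_ge0 : forall x, 0 <= x -> 0 <= phi x.
Hypothesis phi_lt : {in `[0, +oo[ &, {homo phi : x y / x < y}}.
Hypothesis L0 : 0 <= L.
Hypothesis lipG : forall x y, `|G x - G y| <= L * `|x - y|.

Definition mean_phi_error w : R := T.+1%:R^-1 * \sum_(t < T.+1)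
  phi `|Vhat Y X psi Fhat w (Y ord_max w) t - Vtrue Y X psi F t w|.

Definition sup_cdf_error w : R :=
  sup (range (fun v : R => `|Gtilde Y X psi F w v - Gtrue Y X psi F v|)).

Definition last_error w : R :=
  Vhat Y X psi Fhat w (Y ord_max w) ord_max - Vtrue Y X psi F ord_max w.

Let mV t : measurable_fun setT (V t).
Proof. exact: (measurable_psi_pit (hF t) mpsi). Qed.

Let mVh t : measurable_fun setT (Vh t).
Proof. exact: measurableT_comp mpsi (mUh t). Qed.

Let cG : continuous G.
Proof.
move=> x; apply/cvgrPdist_le => e e0; near=> y.
rewrite (le_trans (lipG _ _))//.
(* Enlarging [L] to L + 1 permits division even when L = 0. *)
rewrite (@le_trans _ _ ((L + 1) * `|x - y|)) ?ler_wpM2r ?lerDl//.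
rewrite mulrC -ler_pdivlMr ?ltr_wpDl//; near: y.
by apply: cvgr_dist_le; [exact: cvg_id|rewrite divr_gt0 ?ltr_wpDl].
Unshelve. all: by end_near. Qed.

Let mset v : measurable [set w | V ord_max w <= v].
Proof. exact: measurable_ler_set. Qed.

Let G01 v : 0 <= G v <= 1.
Proof.
rewrite fine_ge0//= -lee_fin fineK ?fin_num_measure//.
by rewrite probability_le1//; exact: mset.
Qed.

Lemma measurable_mean_phi_error : measurable_fun setT mean_phi_error.
Proof.
apply: measurable_funM => //; apply: measurable_sum => t.
by apply: measurable_comp_normr => //; exact: measurable_funB (mVh t) (mV t).
Qed.

Lemma measurable_sup_cdf_error : measurable_fun setT sup_cdf_error.
Proof. exact: (@measurable_sup_ecdf _ _ _ _ V G). Qed.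

Lemma measurable_last_error : measurable_fun setT last_error.
Proof. exact: measurable_funB (mVh _) (mV _). Qed.

Let A := [set w | full_set Y X psi Fhat alpha w (Y ord_max w)].

Let mA : measurable A.
Proof.
apply: measurable_ltr_set => //; apply: measurable_funM => //.
apply: measurable_sum => t; apply: measurableT_comp => //.
exact: measurable_fun_ler (mVh _) (mVh _).
Qed.

(** Markov's inequality in pointwise form: phi(error) / phi(delta) is at least 1 as soon as the
    error exceeds [delta], because [phi] is increasing, so it serves as the weight [c] of the rank
    lemma. *)
Let phat_near w (delta kappa : R) : 0 < delta ->
  mean_phi_error w <= phi delta * kappa -> sup_cdf_error w <= kappa ->
  `|last_error w| <= delta ->
  `|phat Y X psi Fhat w (Y ord_max w) - (1 - G (V ord_max w))|
    <= 2 * kappa + 2 * L * delta.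
Proof.
move=> d0 h1 h2 h3.
have phi0 : 0 < phi delta.
  rewrite (le_lt_trans (phi_ge0 (lexx 0)))//.
  by apply/phi_lt => //; rewrite in_itv/= ?lexx ?ltW.
apply: (@rank_perturbation _ _ (V ^~ w) (Vh ^~ w)
  (fun t => phi `|Vh t w - V t w| / phi delta)) => //.
- by move=> t; rewrite divr_ge0 ?phi_ge0// ltW.
- move=> t dt; rewrite ler_pdivlMr// mul1r ltW//.
  by apply/phi_lt => //; rewrite in_itv/= andbT// ltW.
- by rewrite -mulr_suml mulrA ler_pdivrMr// [leRHS]mulrC.
- move=> v; apply: le_trans h2.
  by apply: sup_upper_bound; [exact: has_sup_ecdf|exists v].
Qed.

(** The exceptional event consists of the three error events and the band where G(V) is within [K]
    of 1 - alpha. As G(V) is uniform, the band has probability 2 K; the bounds on [K] keep it inside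
    [0, 1]. *)
Lemma coverage_bound (q : p.-tuple R -> R) (delta kappa K eps : R) :
  0 < delta -> 2 * kappa + 2 * L * delta <= K -> K < alpha -> K < 1 - alpha ->
  0 <= K -> 0 < eps ->
  cond_prob A (X ord_max) q ->
  (eps%:E * P [set w | (eps < `|q (X ord_max w) - (1 - alpha)|)%R] <=
   2%:E * ((2 * K)%:E + (P [set w | (phi delta * kappa < `|mean_phi_error w|)%R] +
     (P [set w | (kappa < `|sup_cdf_error w|)%R] +
      P [set w | (delta < `|last_error w|)%R]))))%E.
Proof.
move=> d0 hK Ka Ka1 K0 eps0 hq.
set E1 := [set w | phi delta * kappa < _]; set E2 := [set w | kappa < _].
set E3 := [set w | delta < _].
have mabs f : measurable_fun setT f -> measurable_fun setT (fun w : Omega => `|f w : R|).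
  by move=> mf; exact: measurableT_comp.
have mE1 : measurable E1 by apply: measurable_ltr_set => //; exact/mabs/measurable_mean_phi_error.
have mE2 : measurable E2 by apply: measurable_ltr_set => //; exact/mabs/measurable_sup_cdf_error.
have mE3 : measurable E3 by apply: measurable_ltr_set => //; exact/mabs/measurable_last_error.
have mW : measurable_fun setT (fun w => G (V ord_max w)).
  by apply: measurableT_comp => //; exact: continuous_measurable_fun.
pose W u := [set w | G (V ord_max w) < u].
have mWu u : measurable (W u) by exact: measurable_ltr_set.
have PW u C : 0 <= u <= 1 -> measurable C ->
    P (W u `&` X ord_max @^-1` C) = (u%:E * P (X ord_max @^-1` C))%E.
  move=> u01 mC; exact: (cdf_psi_pit_lt (hF ord_max) (cF ord_max) mpsi cG).
have PWT u : 0 <= u <= 1 -> P (W u) = u%:E.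
  move=> u01; have := PW u setT u01 measurableT.
  by rewrite preimage_setT setIT probability_setT mule1.
pose D0 := W (1 - alpha + K) `\` W (1 - alpha - K).
have mD0 : measurable D0 by exact: measurableD.
have PD0 : P D0 = (2 * K)%:E.
  have -> : P D0 = (P (W (1 - alpha + K)%R) -
      P (W (1 - alpha + K)%R `&` W (1 - alpha - K)%R))%E.
    apply: measureD => //; apply: le_lt_trans (ltry 1).
    exact: probability_le1.
  rewrite setIidr; last by move=> w; rewrite /W/=; lra.
  rewrite !PWT -?EFinB; [congr EFin; ring|apply/andP; split; lra..].
pose D := D0 `|` (E1 `|` (E2 `|` E3)).
have mD : measurable D by do !apply: measurableU.
have PD : (P D <= (2 * K)%:E + (P E1 + (P E2 + P E3)))%E.
  rewrite -PD0; apply: le_trans (measureU2 _ mD0 _) _; first by do !apply: measurableU.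
  rewrite leeD2l//; apply: le_trans (measureU2 _ mE1 _) _; first exact: measurableU.
  by rewrite leeD2l//; exact: measureU2.
apply: (@le_trans _ _ (2%:E * P D)%E); last by rewrite lee_pmul2l.
(* Outside [D] the p-value is within [K] of 1 - G(V) while G(V) avoids [1 - alpha - K, 1 - alpha +
   K[, so phat > alpha exactly when G(V) < 1 - alpha. *)
have near w : ~ D w ->
    `|phat Y X psi Fhat w (Y ord_max w) - (1 - G (V ord_max w))| <= K /\ ~ D0 w.
  move=> nD; split; last by move=> ?; apply: nD; left.
  apply: le_trans hK; apply: phat_near => //.
  - by rewrite (le_trans (ler_norm _))// leNgt; apply/negP => ?; apply: nD; right; left.
  - by rewrite (le_trans (ler_norm _))// leNgt; apply/negP => ?; apply: nD; right; right; left.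
  - by rewrite leNgt; apply/negP => ?; apply: nD; right; right; right.
apply: (@cond_prob_near_cst _ _ _ _ _ P (X ord_max) A (W (1 - alpha))) => //.
- by move=> C; apply: PW; apply/andP; split; lra.
- move=> w Aw; have [|nD] := pselect (D w); first by right.
  left; have [+ nD0] := near w nD; rewrite ler_norml /W/= => /andP[h1 h2].
  rewrite ltNge; apply/negP => h; apply: nD0; split; rewrite /W/=.
    by move: Aw; rewrite /A/= /full_set/=; lra.
  by apply/negP; rewrite -leNgt; lra.
- move=> w Bw; have [|nD] := pselect (D w); first by right.
  left; have [+ nD0] := near w nD; rewrite ler_norml /A/full_set/= => /andP[h1 h2].
  rewrite ltNge; apply/negP => h; apply: nD0; split; rewrite /W/=.
    by move: Bw; rewrite /W/=; lra.
  by apply/negP; rewrite -leNgt; move: Bw; rewrite /W/=; lra.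
Qed.

End coverage.

(** * Passage to the limit *)

Lemma cvge_to0P (R : realType) (u : nat -> \bar R) :
  (forall n, (0 <= u n)%E) ->
  u n @[n --> \oo] --> 0%E <->
  forall e : R, 0 < e -> \forall n \near \oo, (u n <= e%:E)%E.
Proof.
move=> u0; split=> [/fine_cvgP[ufin /cvgrPdist_le u_to0] e e0|ue].
  near=> n; have un : u n \is a fin_num by near: n.
  rewrite -(fineK un) lee_fin (le_trans (ler_norm _))//.
  by rewrite -normrN -sub0r; near: n; exact: u_to0.
apply/fine_cvgP; split.
  have := ue 1 ltr01; apply: filterS => n un1.
  by rewrite ge0_fin_numE// (le_lt_trans un1) ?ltry.
apply/cvgrPdist_le => e e0; have := ue e e0; apply: filterS => n une.
have un : u n \is a fin_num by rewrite ge0_fin_numE// (le_lt_trans une) ?ltry.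
by rewrite sub0r normrN /= ger0_norm ?fine_ge0// -lee_fin fineK.
Unshelve. all: by end_near. Qed.

Theorem theorem3 (R : realType)
  (d : nat -> measure_display) (Omega : forall T : nat, measurableType (d T))
  (P : forall T : nat, probability (Omega T) R)
  (p : nat -> nat)
  (Y : forall T : nat, 'I_T.+1 -> {RV (P T) >-> R})
  (X : forall T : nat, 'I_T.+1 -> {RV (P T) >-> (p T).-tuple R})
  (F : forall T : nat, R -> (p T).-tuple R -> R)
  (psi : R -> R)
  (Fhat : forall T : nat,
     ('I_T.+1 -> R * (p T).-tuple R) -> R -> (p T).-tuple R -> R)
  (alpha : R)
  (cond_cdf_F : forall (T : nat) (t : 'I_T.+1), cond_cdf (Y T t) (X T t) (F T))
  (F_continuous : forall (T : nat) (t : 'I_T.+1),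
     {ae P T, forall w, continuous (F T ^~ (X T t w))})
  (psi_measurable : measurable_fun [set: R] psi)
  (Fhat_monotone : forall (T : nat) (z : 'I_T.+1 -> R * (p T).-tuple R)
     (x : (p T).-tuple R), nondecreasing_fun (Fhat T z ^~ x))
  (Uhat_measurable : forall (T : nat) (t : 'I_T.+1),
     measurable_fun [set: Omega T]
       (fun w => Uhat (Y T) (X T) (Fhat T) w (Y T ord_max w) t))
  (alpha01 : 0 < alpha < 1)
  (cond1_phi : exists phi : R -> R,
     [/\ (forall x, 0 <= x -> 0 <= phi x),
         {in `[0, +oo[ &, {homo phi : x y / x < y}},
         {within `[0, +oo[, continuous phi},
         phi 0 = 0
       & oP1 P (fun T w => T.+1%:R^-1 * \sum_(t < T.+1)
           phi `|Vhat (Y T) (X T) psi (Fhat T) w (Y T ord_max w) t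
                 - Vtrue (Y T) (X T) psi (F T) t w|)])
  (cond1_last : oP1 P (fun T w =>
     Vhat (Y T) (X T) psi (Fhat T) w (Y T ord_max w) ord_max
     - Vtrue (Y T) (X T) psi (F T) ord_max w))
  (cond2 : oP1 P (fun T w =>
     sup (range (fun v : R => `|Gtilde (Y T) (X T) psi (F T) w v
                                - Gtrue (Y T) (X T) psi (F T) v|))))
  (cond3 : exists L : R, forall (T : nat) (x1 x2 : R), x1 != x2 ->
     `|Gtrue (Y T) (X T) psi (F T) x1 - Gtrue (Y T) (X T) psi (F T) x2|
       / `|x1 - x2| <= L) :
  forall q : forall T : nat, (p T).-tuple R -> R,
    (forall T : nat,
       cond_prob [set w | full_set (Y T) (X T) psi (Fhat T) alpha w (Y T ord_max w)]
                 (X T ord_max) (q T)) ->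
    oP1 P (fun T w => q T (X T ord_max w) - (1 - alpha)).
Proof.
case: cond1_phi => phi [phi0 phi_lt _ _ cond1].
case: cond3 => L hL.
(* Nonnegativity makes the Lipschitz bound hold for equal arguments too and keeps L' + 1
   positive. *)
pose L' := Num.max 0 L.
have L'0 : 0 <= L' by rewrite le_max lexx.
have lipG T x y : `|Gtrue (Y T) (X T) psi (F T) x - Gtrue (Y T) (X T) psi (F T) y|
    <= L' * `|x - y|.
  have [->|xy] := eqVneq x y; first by rewrite !subrr normr0 mulr0.
  rewrite -ler_pdivrMr ?normr_gt0 ?subr_eq0//.
  by rewrite (le_trans (hL T x y xy))// le_max lexx orbT.
move=> q hq eps eps0; case/andP: alpha01 => alpha0 alpha1.
apply/cvge_to0P => [T|e e0]; first exact: measure_ge0.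
have ee0 : 0 < eps * e by rewrite mulr_gt0.
(* The first term gives 4 K <= eps e / 2 in the final bound; the other two put [K] strictly below
   [alpha] and 1 - alpha. *)
pose K := Num.min (eps * e / 8) (Num.min (alpha / 2) ((1 - alpha) / 2)).
have K0 : 0 < K by rewrite /K !lt_min; apply/and3P; split; lra.
have [K1 K2 K3] : [/\ K <= eps * e / 8, K <= alpha / 2 & K <= (1 - alpha) / 2].
  by rewrite /K; split; rewrite !ge_min lexx ?orbT.
(* Each of 2 kappa and 2 L' delta is at most K / 2. *)
pose delta := K / (4 * (L' + 1)); pose kappa := K / 4.
have delta0 : 0 < delta by rewrite divr_gt0// mulr_gt0// ltr_wpDl.
have hK : 2 * kappa + 2 * L' * delta <= K.
  have : 4 * delta * (L' + 1) = K by rewrite /delta; field; lra.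
  by rewrite /kappa; lra.
have phid : 0 < phi delta.
  rewrite (le_lt_trans (phi0 0 (lexx 0)))//.
  by apply/phi_lt => //; rewrite in_itv/= ?lexx ?ltW.
have pk0 : 0 < phi delta * kappa by rewrite mulr_gt0// divr_gt0.
have k0 : 0 < kappa by rewrite divr_gt0.
(* Three error events of this size, doubled, contribute 3 eps e / 8; with 4 K <= eps e / 2 the total
   stays below eps e. *)
have eta0 : 0 < eps * e / 16 by lra.
have := (cvge_to0P (fun T => measure_ge0 _ _)).1 (cond1 _ pk0) _ eta0.
have := (cvge_to0P (fun T => measure_ge0 _ _)).1 (cond2 _ k0) _ eta0.
have := (cvge_to0P (fun T => measure_ge0 _ _)).1 (cond1_last _ delta0) _ eta0.
apply: filterS3 => T h3 h2 h1.
have := @coverage_bound _ _ _ (P T) (p T) T (Y T) (X T) psi (F T) (Fhat T) phi L'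
  alpha (@cond_cdf_F T) (@F_continuous T) psi_measurable (@Uhat_measurable T) phi0
  phi_lt L'0 (@lipG T) (q T) delta kappa K eps delta0 hK _ _ (ltW K0) eps0 (hq T).
move=> /(_ ltac:(lra) ltac:(lra)) bound.
rewrite -(@lee_pmul2l _ eps%:E)// (le_trans bound)//.
apply: (@le_trans _ _ (2%:E * ((2 * K)%:E +
   ((eps * e / 16)%:E + ((eps * e / 16)%:E + (eps * e / 16)%:E))))%E).
  by rewrite lee_pmul2l// leeD2l// leeD// leeD.
by rewrite -!EFinD -!EFinM lee_fin; lra.
Qed.
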